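(* Let $G$ be a finite graph (directed graph, possibly bi-directed) with adjacency matrix $\mathsf A$. Then, as formal power series in $u$, $$\zeta_{\mathsf A}(u):=\frac{1}{\det(\mathsf I-u\mathsf A)}=\prod_{p_o\in C_G}\frac{1}{1-u^{\ell(p_o)}},$$ where $C_G$ is the set of primitive orbits on $G$ (including those with immediate backtracks). Consequently $$\zeta_{\mathsf A}(u)=\zeta_I(u)\,\zeta_b(u),$$ where $\zeta_I(u)=\prod_{\tilde p_o}(1-u^{\ell(\tilde p_o)})^{-1}$ is the Ihara zeta function, the product being over primitive orbits with no immediate backtrack, and $\zeta_b(u)=\prod_{p_b}(1-u^{\ell(p_b)})^{-1}$ is the product over primitive orbits $p_b\in C_G$ with at least one immediate backtrack.
   Context: A closed walk of length $\ell\geq 1$ on $G$ is a contiguous sequence of arcs $w_{i_1i_2}w_{i_2i_3}\cdots w_{i_\ell i_1}$, where $w_{ij}$ denotes the arc from $v_i$ to $v_j$. Two closed walks define the same orbit if and only if one can be obtained from the other by changing its starting point (cyclic rotation of the arc sequence). The length $\ell(p_o)$ of an orbit is the length of any closed walk in it. An orbit is primitive if it is not a $k$-th power ($k>1$) of another orbit, i.e. its closed walks are not obtained by repeating a shorter closed walk $k>1$ times. An orbit has an immediate backtrack if its cyclic arc sequence contains two consecutive arcs (cyclically) of the form $w_{ij}w_{ji}$ with $i\ne j$. *)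

(* Defs.v *)
From HB Require Import structures.
From mathcomp Require Import all_boot all_order all_algebra.
From mathcomp Require Import generic_quotient finmap.
From mathcomp Require Import boolp classical_sets.

Set Implicit Arguments.
Unset Strict Implicit.
Unset Printing Implicit Defensive.

Import GRing.Theory.
Local Open Scope ring_scope.

(* Formal power series in one variable, given by their coefficient sequences.
   They are wrapped in a record so that [*] is the Cauchy product and not the
   pointwise product of functions. *)

Record fps (R : Type) := Fps { coefs :> nat -> R }.

HB.instance Definition _ (R : Type) := [isNew for @coefs R].
HB.instance Definition _ (R : choiceType) := [Choice of fps R by <:].

Lemma fpsP (R : Type) (f g : fps R) : (forall m, f m = g m) -> f = g.
Proof.
by case: f g => [f] [g] /= fg; congr Fps; apply: functional_extensionality_dep.
Qed.

Section FpsRing.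
Variable R : comUnitRingType.
Implicit Types f g h : fps R.

Definition fps_zero : fps R := Fps (fun=> 0).
Definition fps_opp f : fps R := Fps (fun m => - f m).
Definition fps_add f g : fps R := Fps (fun m => f m + g m).

Lemma fps_addA : associative fps_add.
Proof. by move=> f g h; apply: fpsP => m /=; rewrite addrA. Qed.
Lemma fps_addC : commutative fps_add.
Proof. by move=> f g; apply: fpsP => m /=; rewrite addrC. Qed.
Lemma fps_add0 : left_id fps_zero fps_add.
Proof. by move=> f; apply: fpsP => m /=; rewrite add0r. Qed.
Lemma fps_addN : left_inverse fps_zero fps_opp fps_add.
Proof. by move=> f; apply: fpsP => m /=; rewrite addNr. Qed.

HB.instance Definition _ := GRing.isZmodule.Build (fps R)
  fps_addA fps_addC fps_add0 fps_addN.

Definition fps_one : fps R := Fps (fun m => (m == 0%N)%:R).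
Definition fps_mul f g : fps R :=
  Fps (fun m => \sum_(i < m.+1) f i * g (m - i)%N).

Definition fps_trunc m f : {poly R} := \poly_(i < m.+1) f i.

Lemma coef_fps_trunc m f i : (i <= m)%N -> (fps_trunc m f)`_i = f i.
Proof. by move=> im; rewrite coef_poly ltnS im. Qed.

Lemma fps_mul_trunc m k f g : (k <= m)%N ->
  fps_mul f g k = (fps_trunc m f * fps_trunc m g)`_k.
Proof.
move=> km; rewrite coefM /=; apply: eq_bigr => i _.
have im : (i <= k)%N by rewrite -ltnS.
by rewrite !coef_fps_trunc ?(leq_trans im) // (leq_trans (leq_subr _ _)).
Qed.

Lemma fps_mulA : associative fps_mul.
Proof.
move=> f g h; apply: fpsP => m.
have -> : fps_mul f (fps_mul g h) m =
    (fps_trunc m f * (fps_trunc m g * fps_trunc m h))`_m.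
  rewrite coefM /=; apply: eq_bigr => i _.
  rewrite coef_fps_trunc -1?ltnS //.
  by rewrite -(@fps_mul_trunc m) ?leq_subr.
rewrite mulrA coefM /=; apply: eq_bigr => i _.
rewrite -(@fps_mul_trunc m) -1?ltnS //.
by rewrite coef_fps_trunc ?leq_subr.
Qed.

Lemma fps_mulC : commutative fps_mul.
Proof.
by move=> f g; apply: fpsP => m; rewrite !(@fps_mul_trunc m) // mulrC.
Qed.

Lemma fps_mul1 : left_id fps_one fps_mul.
Proof.
move=> f; apply: fpsP => m /=.
by rewrite big_ord_recl /= mul1r subn0 big1 ?addr0 // => i _; rewrite mul0r.
Qed.

Lemma fps_mulD : left_distributive fps_mul fps_add.
Proof.
move=> f g h; apply: fpsP => m /=; rewrite -big_split /=.
by apply: eq_bigr => i _; rewrite mulrDl.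
Qed.

Lemma fps_one_neq0 : fps_one != 0.
Proof.
by apply/eqP => /(congr1 (fun f : fps R => f 0%N)) /= /eqP; rewrite oner_eq0.
Qed.

HB.instance Definition _ := GRing.Zmodule_isComNzRing.Build (fps R)
  fps_mulA fps_mulC fps_mul1 fps_mulD fps_one_neq0.

Lemma fps1E m : (1 : fps R) m = (m == 0%N)%:R. Proof. by []. Qed.
Lemma fpsME f g m : (f * g) m = \sum_(i < m.+1) f i * g (m - i)%N.
Proof. by []. Qed.

Definition fps_unit : pred (fps R) := fun f => f 0%N \is a GRing.unit.

(* The first [m.+1] coefficients of the inverse of [f]. *)
Fixpoint fps_inv_seq f (m : nat) : seq R :=
  if m is k.+1 then
    let s := fps_inv_seq f k in
    rcons s (- ((f 0%N)^-1 * \sum_(i < m) f (m - i)%N * s`_i))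
  else [:: (f 0%N)^-1].

Definition fps_inv f : fps R :=
  if fps_unit f then Fps (fun m => (fps_inv_seq f m)`_m) else f.

Lemma size_fps_inv_seq f m : size (fps_inv_seq f m) = m.+1.
Proof. by elim: m => //= m IH; rewrite size_rcons IH. Qed.

Lemma nth_fps_inv_seq f m i :
  (i <= m)%N -> (fps_inv_seq f m)`_i = (fps_inv_seq f i)`_i.
Proof.
elim: m => [|m IH]; first by rewrite leqn0 => /eqP->.
rewrite leq_eqVlt => /predU1P[->//|]; rewrite ltnS => im.
by rewrite [in LHS]/= nth_rcons size_fps_inv_seq ltnS im IH.
Qed.

Lemma fps_mulVr : {in fps_unit, left_inverse 1 fps_inv *%R}.
Proof.
move=> f; rewrite -[f \in _]/(fps_unit f) => uf; apply: fpsP => m.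
rewrite mulrC fpsME /fps_inv uf fps1E /=.
case: m => [|m]; first by rewrite big_ord1 /= divrr.
rewrite -(big_mkord xpredT
  (fun i => f i * (fps_inv_seq f (m.+1 - i))`_(m.+1 - i))) big_nat_rev /=.
rewrite add0n big_nat_recr //= subSS subnn nth_rcons size_fps_inv_seq ltnn eqxx.
rewrite mulrN mulrA divrr // mul1r.
apply/eqP; rewrite subr_eq0 big_mkord; apply/eqP/eq_bigr => i _.
have im : (i <= m)%N by rewrite -ltnS.
rewrite subSS subKn ?(leqW im) //.
by rewrite -(nth_fps_inv_seq f im).
Qed.

Lemma fps_unitP f g : g * f = 1 -> fps_unit f.
Proof.
move=> /(congr1 (fun h : fps R => h 0%N)); rewrite fpsME big_ord1 fps1E => gf.
by apply/unitrPr; exists (g 0%N); rewrite mulrC.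
Qed.

Lemma fps_inv_out : {in [predC fps_unit], fps_inv =1 id}.
Proof.
by move=> f /negPf; rewrite /fps_inv -[f \in _]/(fps_unit f) => ->.
Qed.

HB.instance Definition _ := GRing.ComNzRing_hasMulInverse.Build (fps R)
  fps_mulVr fps_unitP fps_inv_out.

Lemma fps_unitE f : (f \is a GRing.unit) = (f 0%N \is a GRing.unit).
Proof. by []. Qed.

Definition fps_poly (p : {poly R}) : fps R := Fps (fun i => p`_i).

End FpsRing.

(* [fps_has_prod P F g]: the product of the [F i], [i] in [P], converges to [g]
   unconditionally, for the topology of coefficientwise convergence: each
   coefficient of the partial products is eventually constant along the finite
   subsets of [P], equal to that of [g]. *)
Section InfiniteProduct.
Variables (R : comUnitRingType) (I : choiceType).
Implicit Types (P : set I) (F : I -> fps R) (g : fps R).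

Definition fps_has_prod P F g : Prop :=
  forall m : nat, exists S0 : {fset I},
    {in S0, forall i, P i} /\
    forall S : {fset I}, {in S, forall i, P i} -> {subset S0 <= S} ->
      (\prod_(i <- S) F i) m = g m.

Definition fps_multipliable P F : Prop := exists g, fps_has_prod P F g.

(* The value is [1] (and meaningless) when the product does not converge. *)
Definition fps_prod P F : fps R := xget 1 [set g | fps_has_prod P F g]%classic.

Lemma fps_has_prod_unique P F g1 g2 :
  fps_has_prod P F g1 -> fps_has_prod P F g2 -> g1 = g2.
Proof.
move=> h1 h2; apply: fpsP => m.
have [S1 [P1 E1]] := h1 m; have [S2 [P2 E2]] := h2 m.
have PU : {in (S1 `|` S2)%fset, forall i, P i}.
  by move=> i; rewrite inE => /orP[/P1|/P2].
by rewrite -(E1 _ PU) ?(E2 _ PU) // => i iS; rewrite inE iS ?orbT.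
Qed.

Lemma fps_prodE P F g : fps_has_prod P F g -> fps_prod P F = g.
Proof.
by move=> h; apply: (fps_has_prod_unique _ h); exact: (@xgetPex _ 1
  [set g | fps_has_prod P F g]%classic (ex_intro _ g h)).
Qed.

End InfiniteProduct.

(* A finite directed graph on the vertices [v_0, ..., v_(n-1)] is a relation
   [e : rel 'I_n]; loops and pairs of opposite arcs are allowed. *)

Definition adjacency (n : nat) (e : rel 'I_n) : 'M[int]_n :=
  \matrix_(i, j) (e i j)%:R.

Definition det_1_sub_uA (n : nat) (A : 'M[int]_n) : {poly int} :=
  \det (1%:M - 'X *: map_mx polyC A).

Definition zeta (n : nat) (A : 'M[int]_n) : fps int :=
  1 / fps_poly (det_1_sub_uA A).

Lemma det_1_sub_uA_unit (n : nat) (A : 'M[int]_n) :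
  fps_poly (det_1_sub_uA A) \is a GRing.unit.
Proof.
rewrite fps_unitE /= -horner_coef0 /det_1_sub_uA.
rewrite -[_.[0]]/(horner_eval 0 _) -det_map_mx.
rewrite (_ : map_mx _ _ = 1%:M) ?det1 ?unitr1 //.
apply/matrixP => i j; rewrite !mxE rmorphB rmorphM rmorph_nat /=.
by rewrite [horner_eval 0 'X]hornerX mul0r subr0.
Qed.

Definition arc_of (n : nat) := ('I_n * 'I_n)%type.

Definition is_closed_walk (n : nat) (e : rel 'I_n) (w : seq (arc_of n)) : bool :=
  [&& w != [::], all (fun a => e a.1 a.2) w & cycle (fun a b => a.2 == b.1) w].

Record closed_walk (n : nat) (e : rel 'I_n) := ClosedWalk {
  arcs :> seq (arc_of n);
  closed_walkP : is_closed_walk e arcs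
}.

HB.instance Definition _ (n : nat) (e : rel 'I_n) := [isSub for @arcs n e].
HB.instance Definition _ (n : nat) (e : rel 'I_n) :=
  [Choice of closed_walk e by <:].

Section Orbits.
Local Open Scope quotient_scope.
Variables (n : nat) (e : rel 'I_n).
Implicit Types (v w : closed_walk e).

Definition same_orbit v w : bool :=
  [exists k : 'I_(size v), rot k v == w :> seq (arc_of n)].

Lemma same_orbitP v w :
  reflect (exists k, rot k v = w :> seq (arc_of n)) (same_orbit v w).
Proof.
apply: (iffP existsP) => [[k /eqP kw]|[k kw]]; first by exists k.
have v_gt0 : (0 < size v)%N.
  by rewrite lt0n size_eq0; case/and3P: (closed_walkP v).
have [kv|vk] := ltnP k (size v); first by exists (Ordinal kv); apply/eqP.
exists (Ordinal v_gt0); apply/eqP; rewrite /= rot0 -kw.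
by rewrite rot_oversize.
Qed.

Lemma same_orbit_refl : reflexive same_orbit.
Proof. by move=> w; apply/same_orbitP; exists 0%N; rewrite rot0. Qed.

Lemma same_orbit_sym : symmetric same_orbit.
Proof.
suff H v w : same_orbit v w -> same_orbit w v.
  by move=> v w; apply/idP/idP; apply: H.
case/same_orbitP => k kw; apply/same_orbitP.
by exists (size (rot k v) - k)%N; rewrite -kw; exact: rotK.
Qed.

Lemma same_orbit_trans : transitive same_orbit.
Proof.
move=> v u w /same_orbitP[k kv] /same_orbitP[l lw]; apply/same_orbitP.
by exists (rot_add u k l); rewrite -rot_rot_add kv.
Qed.

Canonical same_orbit_equiv :=
  EquivRel same_orbit same_orbit_refl same_orbit_sym same_orbit_trans.

Definition walk_orbit := {eq_quot same_orbit}.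
HB.instance Definition _ := Choice.on walk_orbit.
HB.instance Definition _ := EqQuotient.on walk_orbit.

Definition orbit_length (o : walk_orbit) : nat := size (repr o).

Lemma orbit_length_pi w : orbit_length (\pi_walk_orbit w) = size w.
Proof.
have /eqP : \pi_walk_orbit (repr (\pi_walk_orbit w)) = \pi_walk_orbit w.
  exact: reprK.
rewrite eqmodE /= => /same_orbitP[k kw].
by rewrite /orbit_length -kw size_rot.
Qed.

Definition primitive_walk w : Prop :=
  ~ exists (k : nat) (v : closed_walk e),
      (1 < k)%N /\ arcs w = flatten (nseq k (arcs v)).

Definition primitive (o : walk_orbit) : Prop :=
  forall w, \pi_walk_orbit w = o -> primitive_walk w.

(* [zip w (rot 1 w)] lists the pairs of cyclically consecutive arcs of [w]. *)
Definition walk_backtracks w : bool :=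
  has (fun ab : arc_of n * arc_of n =>
         (ab.1.1 != ab.1.2) && (ab.2 == (ab.1.2, ab.1.1)))
      (zip w (rot 1 w)).

Definition backtracks (o : walk_orbit) : Prop :=
  exists2 w, \pi_walk_orbit w = o & walk_backtracks w.

Definition euler_factor (o : walk_orbit) : fps int :=
  1 / fps_poly (1 - 'X^(orbit_length o)).

Lemma euler_factor_unit (o : walk_orbit) :
  fps_poly (1 - 'X^(orbit_length o) : {poly int}) \is a GRing.unit.
Proof.
rewrite fps_unitE /= coefB coef1 coefXn /= eq_sym.
rewrite /orbit_length size_eq0; case/and3P: (closed_walkP (repr o)).
by move=> /negPf -> _ _; rewrite subr0 unitr1.
Qed.

End Orbits.

Arguments euler_factor {n} e o.

Section Zetas.
Variables (n : nat) (e : rel 'I_n).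
Local Open Scope classical_set_scope.

Definition primitive_orbits : set (walk_orbit e) := [set o | primitive o].
Definition nonbacktracking_primitive_orbits : set (walk_orbit e) :=
  [set o | primitive o /\ ~ backtracks o].
Definition backtracking_primitive_orbits : set (walk_orbit e) :=
  [set o | primitive o /\ backtracks o].

Definition zeta_I : fps int :=
  fps_prod nonbacktracking_primitive_orbits (euler_factor e).
Definition zeta_b : fps int :=
  fps_prod backtracking_primitive_orbits (euler_factor e).

End Zetas.

Arguments primitive_orbits {n} e.
Arguments nonbacktracking_primitive_orbits {n} e.
Arguments backtracking_primitive_orbits {n} e.

(* Main.v *)
Require Import Defs.
From HB Require Import structures.
From mathcomp Require Import all_boot all_order all_algebra perm.
From mathcomp Require Import generic_quotient finmap.
From mathcomp Require Import boolp classical_sets.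

Set Implicit Arguments.
Unset Strict Implicit.
Unset Printing Implicit Defensive.

Import GRing.Theory.

(* Both sides have constant term 1, so it suffices to compare their logarithmic
   derivatives.  With [theta = u d/du], Jacobi's formula for the derivative of
   a determinant gives [theta zeta_A = (\sum_(k > 0) tr(A^k) u^k) zeta_A], while
   an orbit of length [l] contributes [\sum_(l | k, k > 0) l u^k] to the
   logarithmic derivative of the product.  These agree because [tr(A^k)] counts
   the closed walks of length [k], and each of them is, in exactly one way, a
   power of one of the [l] rotations of a primitive closed walk of length [l]
   dividing [k].  The factorization by backtracking is the splitting of a
   convergent product over two disjoint sets of orbits. *)

(** * Periods of words *)

Section Words.
Variable T : eqType.
Implicit Types (v w : seq T) (r : rel T).

Lemma flatten_nseqS q v : flatten (nseq q.+1 v) = v ++ flatten (nseq q v).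
Proof. by []. Qed.

Lemma size_flatten_nseq q v : size (flatten (nseq q v)) = q * size v.
Proof. by elim: q => //= q IH; rewrite size_cat IH mulSn. Qed.

Lemma flatten_nseq_rcat q v : flatten (nseq q v) ++ v = v ++ flatten (nseq q v).
Proof. by elim: q => [|q IH]; rewrite ?cats0 //= -catA IH. Qed.

Lemma rot_flatten_nseq q v :
  rot (size v) (flatten (nseq q v)) = flatten (nseq q v).
Proof.
by case: q => [|q] //=; rewrite rot_size_cat flatten_nseq_rcat.
Qed.

Lemma all_flatten_nseq (a : pred T) q v :
  all a (flatten (nseq q.+1 v)) = all a v.
Proof.
by elim: q => [|q IH]; rewrite flatten_nseqS all_cat ?andbT // IH andbb.
Qed.

Lemma cycle_flatten_nseq r q v : cycle r (flatten (nseq q.+1 v)) = cycle r v.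
Proof.
case: v => [|x v]; first by rewrite (_ : flatten _ = [::]) //; elim: q.
(* Extra copies of [x :: v] only repeat the checks already made on the way from [x] round to [x]. *)
suff H p : path r x (v ++ flatten (nseq p (x :: v)) ++ [:: x]) =
    path r x (v ++ [:: x]).
  by rewrite flatten_nseqS /= -cats1 -catA H cats1.
elim: p => //= p IH; rewrite cat_path /= -catA IH.
by rewrite !cat_path /= andbT; case: path => //=; case: (r _ x).
Qed.

(** [rot] is the identity beyond the length of the word, so it is not additive in its index;
    iterates of [rot 1] are, as the Bezout argument requires. *)
Lemma iter_rot1 k w : k <= size w -> iter k (rot 1) w = rot k w.
Proof.
elim: k => [|k IH] kw; first by rewrite rot0.
rewrite iterS (IH (ltnW kw)); apply: esym; exact: (rotD (m := 1) kw).
Qed.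

Lemma iter_rot1_mul k a w : iter a (rot 1) w = w -> iter (k * a) (rot 1) w = w.
Proof. by move=> aw; elim: k => // k IH; rewrite mulSn iterD IH. Qed.

(** Bezout gives [u * a = v * b + gcdn a b]: the first [v * b] steps fix [w], and so do all [u * a]
    steps together. *)
Lemma rot_gcdn a b w : 0 < a <= size w -> b <= size w ->
  rot a w = w -> rot b w = w -> rot (gcdn a b) w = w.
Proof.
case/andP=> a0 aw bw; rewrite -!iter_rot1 //; last first.
  by rewrite (leq_trans _ aw) // dvdn_leq ?dvdn_gcdl.
move=> ra rb; case: (egcdnP b a0) => u v uv _.
by rewrite -[in LHS](iter_rot1_mul v rb) -iterD addnC -uv iter_rot1_mul.
Qed.

(** For [q > 0], comparing the two products shows that [v] is a prefix of [x]; cancelling it leaves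
    a word that still commutes with [v]. *)
Lemma commuting_word q v x :
  size x = q * size v -> v ++ x = x ++ v -> x = flatten (nseq q v).
Proof.
elim: q x => [|q IH] x xq vx; first by apply/eqP; rewrite -size_eq0 xq.
have vlex : size v <= size x by rewrite xq mulSn leq_addr.
have xE : v ++ drop (size v) x = x.
  rewrite -[RHS](cat_take_drop (size v)); congr (_ ++ _).
  by rewrite -(takel_cat v vlex) -vx take_size_cat.
rewrite flatten_nseqS -(IH (drop (size v) x)) ?xE //.
  by rewrite size_drop xq mulSn addKn.
move: vx; rewrite -[in RHS]xE -catA => /eqP; rewrite eqseq_cat // eqxx /=.
by move=> /eqP.
Qed.

(** Invariance under [rot d] says that [take d w] and [drop d w] commute. *)
Lemma rot_period d w : d %| size w -> rot d w = w ->
  w = flatten (nseq (size w %/ d) (take d w)).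
Proof.
have [->|w0 dw rw] := eqVneq w [::]; first by rewrite div0n.
have w_gt0 : 0 < size w by rewrite lt0n size_eq0.
have d0 : 0 < d by exact: dvdn_gt0 dw.
have tw : size (take d w) = d by rewrite size_takel // dvdn_leq.
have [q wq] := dvdnP dw.
have q0 : 0 < q by move: w_gt0; rewrite wq muln_gt0 => /andP[].
case: q q0 wq => // q _ wq; rewrite wq mulnK // flatten_nseqS.
rewrite -[LHS](cat_take_drop d); congr (_ ++ _); apply: commuting_word.
  by rewrite size_drop tw wq mulSn addKn.
by rewrite cat_take_drop -[LHS]rw.
Qed.

Definition aperiodic w := forall k, 0 < k < size w -> rot k w <> w.

Lemma aperiodic_rot k w : aperiodic w -> aperiodic (rot k w).
Proof.
move=> aw j; rewrite size_rot => jw; rewrite rot_rot => /rot_inj; exact: aw.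
Qed.

Lemma aperiodic_inj w i j : aperiodic w -> i < size w -> j < size w ->
  rot i w = rot j w -> i = j.
Proof.
move=> aw; wlog ij : i j / i <= j => [H|] iw jw rij.
  by have [/H->|/ltnW/H H'] := leqP i j; rewrite // -H'.
move: ij; rewrite leq_eqVlt => /predU1P[//|ij].
have /aw[] : 0 < j - i < size w.
  by rewrite subn_gt0 ij (leq_ltn_trans (leq_subr _ _) jw).
by apply: (rot_inj (n0 := i)); rewrite -rotD ?subnKC ?rij // ltnW.
Qed.

(** The common power [w] is fixed by the rotations by both lengths, hence by their gcd [g]. This
    period descends to the longer word [v'], so [g = size v'] by aperiodicity; the lengths agree and
    both words are the same prefix of [w]. *)
Lemma aperiodic_root v v' q q' : aperiodic v -> aperiodic v' ->
  0 < size v -> 0 < size v' -> 0 < q -> 0 < q' ->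
  flatten (nseq q v) = flatten (nseq q' v') -> v = v'.
Proof.
wlog vv' : v v' q q' / size v <= size v' => [H|] av av' v0 v'0 q0 q'0 E.
  have [vv'|/ltnW vv'] := leqP (size v) (size v'); first exact: (H _ _ q q').
  by apply/esym/(H _ _ q' q).
set w := flatten _ in E; pose g := gcdn (size v) (size v').
have sw : size w = q * size v by rewrite size_flatten_nseq.
have sw' : size w = q' * size v' by rewrite E size_flatten_nseq.
have rg : rot g w = w.
  apply: rot_gcdn; rewrite ?v0 ?sw ?leq_pmull //; last first.
  - by rewrite E rot_flatten_nseq.
  - exact: rot_flatten_nseq.
  - by rewrite -sw sw' leq_pmull.
have gv' : g %| size v' := dvdn_gcdr _ _.
have g0 : 0 < g by rewrite gcdn_gt0 v0.
have gw : g %| size w by rewrite sw' dvdn_mull.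
have vE : v = take (size v) w.
  by rewrite /w -(prednK q0) flatten_nseqS take_size_cat.
have v'E : v' = take (size v') w.
  by rewrite E -(prednK q'0) flatten_nseqS take_size_cat.
have rv' : rot g v' = v'.
  have [k kv'] := dvdnP gv'.
  have tw : size (take g w) = g.
    rewrite size_takel // dvdn_leq // sw muln_gt0 v0 q0 //.
  have kw : k <= size w %/ g.
    by rewrite leq_divRL // -kv' sw' leq_pmull.
  rewrite v'E [w](rot_period gw rg) -(subnKC kw) nseqD flatten_cat.
  by rewrite take_size_cat ?size_flatten_nseq ?tw // -{1}tw rot_flatten_nseq.
have gE : g = size v'.
  apply/eqP; rewrite eqn_leq dvdn_leq //= leqNgt; apply/negP => gv.
  by apply: (av' g); rewrite ?g0.
have vv : size v = size v'.
  by apply/eqP; rewrite eqn_leq vv' -gE dvdn_leq ?dvdn_gcdl.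
by rewrite vE v'E vv.
Qed.

(* [d] is the least rotation fixing [w]. *)
Lemma exists_root w : w != [::] -> exists d, [/\ 0 < d, d %| size w,
  rot d w = w & aperiodic (take d w)].
Proof.
move=> w0; have sw : 0 < size w by case: w w0.
have exP : exists d, (0 < d) && (rot d w == w).
  by exists (size w); rewrite sw rot_size eqxx.
case: (ex_minnP exP) => d /andP[d0 /eqP rd] dmin.
have dw : d <= size w by apply: dmin; rewrite sw rot_size eqxx.
(* Rotation by [gcdn d (size w)] also fixes [w], so minimality makes it equal to [d]. *)
have dvd : d %| size w.
  suff <- : gcdn d (size w) = d by exact: dvdn_gcdr.
  apply/eqP; rewrite eqn_leq dvdn_leq ?dvdn_gcdl //=.
  by apply: dmin; rewrite gcdn_gt0 d0 rot_gcdn ?d0 ?rot_size ?eqxx.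
exists d; split=> // k; rewrite size_takel // => /andP[k0 kd] rk.
(* A shorter rotation fixing the prefix gives it the period [gcdn k d], which spreads to all of [w]
   and contradicts the minimality of [d]. *)
have: d <= gcdn k d.
  apply: dmin; rewrite gcdn_gt0 k0 /=; apply/eqP.
  have gd : gcdn k d %| d := dvdn_gcdr _ _.
  have td : size (take d w) = d by rewrite size_takel.
  have rg : rot (gcdn k d) (take d w) = take d w.
    by apply: rot_gcdn; rewrite ?td ?k0 ?(ltnW kd) // -{1}td rot_size.
  have [q qd] := dvdnP gd.
  have := rot_period _ rg; rewrite td => /(_ gd) tE.
  have [p wE] : exists p, w = flatten (nseq p (take (gcdn k d) (take d w))).
    exists (size w %/ d * (d %/ gcdn k d)).
    rewrite {1}(rot_period dvd rd) {1}tE.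
    elim: (size w %/ d) => // p IH.
    by rewrite flatten_nseqS IH -flatten_cat -nseqD mulSn.
  have tk : size (take (gcdn k d) (take d w)) = gcdn k d.
    by rewrite size_takel // td dvdn_leq.
  by rewrite {1}wE -{1}tk rot_flatten_nseq -wE.
by apply/negP; rewrite -ltnNge (leq_ltn_trans _ kd) // dvdn_leq ?dvdn_gcdl.
Qed.
End Words.

Local Open Scope ring_scope.

(** * Logarithmic derivatives of power series *)

Section FpsTheta.
Variable R : comUnitRingType.
Implicit Types f g : fps R.

Lemma fpsDE f g k : (f + g) k = f k + g k. Proof. by []. Qed.
Lemma fpsNE f k : (- f) k = - f k. Proof. by []. Qed.

Lemma fps_sumE (I : Type) (r : seq I) (P : pred I) (F : I -> fps R) k :
  (\sum_(i <- r | P i) F i) k = \sum_(i <- r | P i) F i k.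
Proof. by apply: (big_morph (fun f : fps R => f k)). Qed.

Lemma fps_poly_is_zmod_morphism : zmod_morphism (@fps_poly R).
Proof. by move=> p q; apply: fpsP => k; rewrite /= coefB. Qed.

Lemma fps_poly_is_monoid_morphism : monoid_morphism (@fps_poly R).
Proof.
split=> [|p q]; apply: fpsP => k; first by rewrite fps1E /= coef1.
by rewrite fpsME /= coefM.
Qed.

HB.instance Definition _ := GRing.isZmodMorphism.Build _ _ (@fps_poly R)
  fps_poly_is_zmod_morphism.
HB.instance Definition _ := GRing.isMonoidMorphism.Build _ _ (@fps_poly R)
  fps_poly_is_monoid_morphism.

Lemma fps_mulXn f d k :
  (f * fps_poly 'X^d) k = if (d <= k)%N then f (k - d)%N else 0.
Proof.
rewrite mulrC fpsME; case: leqP => [dk|kd]; last first.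
  rewrite big1 // => i _; rewrite /= coefXn ltn_eqF ?mul0r //.
  by rewrite (leq_ltn_trans _ kd) // -ltnS.
have dk1 : (d < k.+1)%N by [].
rewrite (bigD1 (Ordinal dk1)) //= coefXn eqxx mul1r big1 ?addr0 // => i.
by rewrite -val_eqE /= coefXn => /negPf->; rewrite mul0r.
Qed.

(* The Euler operator [u d/du], for which no division by [u] occurs in the
   logarithmic derivatives below. *)
Definition fps_theta f : fps R := Fps (fun k => f k *+ k).

Lemma fps_theta_is_zmod_morphism : zmod_morphism fps_theta.
Proof. by move=> f g; apply: fpsP => k; exact: mulrnBl. Qed.

HB.instance Definition _ := GRing.isZmodMorphism.Build _ _ fps_theta
  fps_theta_is_zmod_morphism.

Lemma fps_thetaM f g : fps_theta (f * g) = fps_theta f * g + f * fps_theta g.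
Proof.
apply: fpsP => k; rewrite fpsDE !fpsME /= -sumrMnl -big_split /=.
apply: eq_bigr => i _; rewrite mulrnAl mulrnAr -mulrnDr subnKC //.
by rewrite -ltnS.
Qed.

Lemma fps_theta1 : fps_theta 1 = 0.
Proof. by apply: fpsP => -[|k]; rewrite /= /GRing.one //= mul0rn. Qed.

Lemma fps_thetaX : fps_theta (fps_poly 'X) = fps_poly 'X.
Proof. by apply: fpsP => -[|[|k]]; rewrite /= coefX //= mul0rn. Qed.

Lemma fps_theta_prod (I : Type) (r : seq I) (F L : I -> fps R) :
  (forall i, fps_theta (F i) = L i * F i) ->
  fps_theta (\prod_(i <- r) F i) = (\sum_(i <- r) L i) * \prod_(i <- r) F i.
Proof.
move=> FL; elim: r => [|i r IH]; first by rewrite !big_nil fps_theta1 mul0r.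
rewrite !big_cons fps_thetaM IH FL mulrDl -!mulrA; congr (_ + _).
by rewrite mulrCA.
Qed.

(** Apply [fps_theta] to [f^-1 * f = 1]. *)
Lemma fps_theta_inv f g :
  f \is a GRing.unit -> fps_theta f = - g * f -> fps_theta f^-1 = g * f^-1.
Proof.
move=> uf fg; apply: (mulIr uf); rewrite -mulrA mulVr // mulr1.
have := fps_thetaM f^-1 f; rewrite mulVr // fps_theta1 fg mulrCA mulVr // mulr1.
by move/esym/eqP; rewrite subr_eq0 => /eqP.
Qed.

End FpsTheta.

(* The equation [theta f = L f] determines [k f_k] from the lower coefficients
   as soon as [L_0 = 0]. *)
Lemma fps_theta_uniq (f g L1 L2 : fps int) m :
  fps_theta f = L1 * f -> fps_theta g = L2 * g -> f 0%N = g 0%N ->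
  L1 0%N = 0 -> (forall k, (k <= m)%N -> L1 k = L2 k) ->
  forall k, (k <= m)%N -> f k = g k.
Proof.
move=> fL gL fg0 L10 L12; elim/ltn_ind => -[|k] IH km //.
(* The integers are torsion-free, so coefficients may be compared after multiplication by [k.+1]. *)
apply/eqP; rewrite -(Num.Theory.eqr_pMn2r (ltn0Sn k)).
apply/eqP; rewrite -[f _ *+ _]/(fps_theta f k.+1).
rewrite -[g _ *+ _]/(fps_theta g k.+1) fL gL.
(* Only the summand of index 0 involves the coefficient [k.+1] of [f] or [g], and the vanishing of
   [L1 0] removes it. *)
rewrite !fpsME big_ord_recl [RHS]big_ord_recl /= -L12 // L10 !mul0r.
congr (_ + _).
apply: eq_bigr => i _; rewrite /bump /= add1n subSS L12; last first.
  by rewrite (leq_trans _ km).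
by rewrite IH // ?ltnS ?leq_subr // (leq_trans (leq_subr _ _)) // ltnW.
Qed.

(** * Jacobi's formula for an arbitrary derivation *)

Section Jacobi.
Variables (R : comNzRingType) (D : {additive R -> R}).
Hypothesis DM : forall x y, D (x * y) = D x * y + x * D y.

Lemma derivation1 : D 1 = 0.
Proof.
have := DM 1 1; rewrite !mulr1 mul1r => /eqP.
by rewrite -subr_eq0 opprD addNKr oppr_eq0 => /eqP.
Qed.

Lemma derivation_prod n (F : 'I_n -> R) :
  D (\prod_j F j) = \sum_i \prod_j if j == i then D (F j) else F j.
Proof.
elim: n F => [|n IH] F; first by rewrite !big_ord0 derivation1.
rewrite !big_ord_recl DM IH eqxx; congr (_ * _ + _).
rewrite mulr_sumr; apply: eq_bigr => i _.
by rewrite big_ord_recl /=; congr (_ * _).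
Qed.

(** Differentiating the Leibniz expansion gives the sum of the determinants of [N i], where row [i]
    of [M] is differentiated. Expanding along that row, whose cofactors are those of [M], gives the
    diagonal entries of the product with the adjugate. *)
Lemma derivation_det n (M : 'M[R]_n) : D (\det M) = \tr (map_mx D M *m \adj M).
Proof.
pose N i : 'M_n := \matrix_(k, j) if k == i then D (M k j) else M k j.
transitivity (\sum_i \det (N i)).
  rewrite /determinant raddf_sum exchange_big; apply: eq_bigr => s _ /=.
  rewrite -mulr_sumr !mulr_sign.
  have -> : \sum_i \prod_j N i j (s j) = D (\prod_j M j (s j)).
    rewrite derivation_prod; apply: eq_bigr => i _.
    by apply: eq_bigr => j _; rewrite mxE.
  by case: ifP; rewrite ?raddfN.
rewrite /mxtrace; apply: eq_bigr => i _; rewrite (expand_det_row _ i) mxE.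
apply: eq_bigr => j _; rewrite !mxE eqxx; congr (_ * (_ * \det _)).
by apply/matrixP => k l; rewrite !mxE eq_sym (negPf (neq_lift _ _)).
Qed.

End Jacobi.

(** Passing from polynomials to power series puts the determinant where [fps_theta] acts. *)
Lemma det_1_sub_uAE n (A : 'M[int]_n) :
  fps_poly (det_1_sub_uA A) =
    \det (1%:M - fps_poly 'X *: map_mx (@fps_poly _ \o polyC) A).
Proof.
rewrite /det_1_sub_uA -det_map_mx; congr (\det _); apply/matrixP => i j.
by rewrite !mxE rmorphB rmorphM rmorph_nat.
Qed.

Lemma fps_thetaC (a : int) : fps_theta (fps_poly a%:P) = 0.
Proof. by apply: fpsP => -[|k]; rewrite /= coefC //= mul0rn. Qed.

(** The constant term is 0 rather than the trace of the identity, since a logarithmic derivative by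
    [u d/du] has none. *)
Definition fps_trace n (A : 'M[int]_n) : fps int :=
  Fps (fun k => if k is _.+1 then \tr (A ^+ k) else 0).

(** With [M = I - uA] and [S] its inverse, Jacobi's formula gives
    [theta (det M) = - det M * tr(uA S)], and [tr(uA S)] is [fps_trace A]. *)
Lemma theta_zeta n (A : 'M[int]_n) :
  fps_theta (zeta A) = fps_trace A * zeta A.
Proof.
rewrite /zeta div1r; apply: fps_theta_inv; first exact: det_1_sub_uA_unit.
rewrite det_1_sub_uAE; set B := map_mx _ A; set x := fps_poly 'X.
set M := 1%:M - _; rewrite (derivation_det (@fps_thetaM _)).
have -> : map_mx (@fps_theta _) M = - (x *: B).
  apply/matrixP => i j; rewrite !mxE raddfB /= fps_thetaM fps_thetaX.
  rewrite fps_thetaC mulr0 addr0.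
  by case: (i == j); rewrite /= ?fps_theta1 ?raddf0 sub0r.
(* [S] is the resolvent [\sum_k u^k A^k]. *)
pose S : 'M[fps int]_n := \matrix_(i, j) Fps (fun k => (A ^+ k) i j).
have xE (f : fps int) k : (x * f) k = if k is k'.+1 then f k' else 0.
  by rewrite mulrC /x -['X]expr1 fps_mulXn; case: k => // k; rewrite subn1.
have BSE i j : (B *m S) i j = Fps (fun k => (A ^+ k.+1) i j).
  apply: fpsP => k; rewrite mxE fps_sumE /= exprS mxE; apply: eq_bigr => l _.
  rewrite !mxE big_ord_recl /= coefC /= subn0 big1 ?addr0 // => t _.
  by rewrite coefC mul0r.
(* The series [S - uAS] telescopes to its constant term. *)
have MS : M *m S = 1%:M.
  rewrite mulmxBl mul1mx -scalemxAl; apply/matrixP => i j; apply: fpsP => k.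
  rewrite mxE mxE [X in _ + X]mxE [(x *: (B *m S)) i j]mxE fpsDE fpsNE BSE xE.
  rewrite !mxE /=; case: k => [|k].
    by rewrite subr0 expr0 mxE; case: (i == j).
  by rewrite subrr; case: (i == j).
have -> : \adj M = \det M *: S.
  by rewrite -[\adj M]mulmx1 -MS mulmxA mul_adj_mx mul_scalar_mx.
rewrite -scalemxAr mxtraceZ mulNmx raddfN /= mulrN mulNr mulrC.
congr (- (_ * _)).
apply: fpsP => k; rewrite /mxtrace fps_sumE.
rewrite -scalemxAl; under eq_bigr => i _ do rewrite mxE BSE xE.
by case: k => [|k] //=; rewrite big1.
Qed.

Lemma coef0_det_1_sub_uA n (A : 'M[int]_n) : (det_1_sub_uA A)`_0 = 1.
Proof.
rewrite -horner_coef0 /det_1_sub_uA -[_.[0]]/(horner_eval 0 _) -det_map_mx.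
rewrite (_ : map_mx _ _ = 1%:M) ?det1 //.
apply/matrixP => i j; rewrite !mxE rmorphB rmorphM rmorph_nat /=.
by rewrite [horner_eval 0 'X]hornerX mul0r subr0.
Qed.

Lemma zeta0 n (A : 'M[int]_n) : zeta A 0%N = 1.
Proof.
have u := det_1_sub_uA_unit A.
have /(congr1 (fun f : fps int => f 0%N)) :
    zeta A * fps_poly (det_1_sub_uA A) = 1.
  by rewrite /zeta div1r mulVr.
by rewrite fpsME big_ord1 /= coef0_det_1_sub_uA mulr1.
Qed.

(** * Truncated coefficients and infinite products *)

Section Truncation.
Variable R : comUnitRingType.
Implicit Types f g : fps R.

Lemma fps_mul_eq1 m f g : (forall k, (k <= m)%N -> g k = (1 : fps R) k) ->
  forall k, (k <= m)%N -> (f * g) k = f k.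
Proof.
move=> g1 k km; rewrite -[in RHS](mulr1 f) !fpsME; apply: eq_bigr => i _.
by rewrite g1 // (leq_trans (leq_subr _ _)).
Qed.

Lemma fps_prod_eq1 (I : Type) m (r : seq I) (P : pred I) (F : I -> fps R) :
  (forall i, P i -> forall k, (k <= m)%N -> F i k = (1 : fps R) k) ->
  forall k, (k <= m)%N -> (\prod_(i <- r | P i) F i) k = (1 : fps R) k.
Proof.
move=> F1.
apply: (big_ind (fun f : fps R => forall k, (k <= m)%N -> f k = (1 : fps R) k)).
- by [].
- by move=> f g f1 g1 k km; rewrite (fps_mul_eq1 _ g1) ?f1.
- exact: F1.
Qed.

End Truncation.

Section InfiniteProducts.
Variables (R : comUnitRingType) (I : choiceType).
Implicit Types (P : set I) (F : I -> fps R) (g : fps R).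

(** Convergence supplies one finite set per coefficient; a Cauchy product needs one set for all
    coefficients up to [m], namely a union. *)
Lemma fps_has_prod_le P F g m : fps_has_prod P F g ->
  exists S0 : {fset I}, {in S0, forall i, P i} /\
    forall S : {fset I}, {in S, forall i, P i} -> {subset S0 <= S} ->
      forall k, (k <= m)%N -> (\prod_(i <- S) F i) k = g k.
Proof.
move=> Pg; elim: m => [|m [S0 [P0 E0]]].
  have [S0 [P0 E0]] := Pg 0%N; exists S0; split=> // S PS S0S k.
  by rewrite leqn0 => /eqP->; exact: E0.
have [S1 [P1 E1]] := Pg m.+1; exists (S0 `|` S1)%fset; split.
  by move=> i; rewrite inE => /orP[/P0|/P1].
move=> S PS SS k; rewrite leq_eqVlt => /predU1P[->|km].
  by apply: E1 => // i i1; apply: SS; rewrite inE i1 orbT.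
by apply: E0 => // i i0; apply: SS; rewrite inE i0.
Qed.

(** A finite set containing both thresholds splits into its parts inside and outside [P1]; by
    disjointness each part contains its own threshold. *)
Lemma fps_has_prodU P1 P2 F g1 g2 : [disjoint P1 & P2]%classic ->
  fps_has_prod P1 F g1 -> fps_has_prod P2 F g2 ->
  fps_has_prod (P1 `|` P2)%classic F (g1 * g2).
Proof.
move=> /disj_setPS P12 h1 h2 m.
have [S1 [PS1 E1]] := fps_has_prod_le m h1.
have [S2 [PS2 E2]] := fps_has_prod_le m h2.
exists (S1 `|` S2)%fset; split=> [i|S PS SS].
  by rewrite inE => /orP[/PS1|/PS2]; [left|right].
have PS' i : i \in S -> ~ P1 i -> P2 i by move=> /PS[].
rewrite (bigID (fun i => `[< P1 i >]))
  (big_fset_condE _ S (fun i => `[< P1 i >])).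
rewrite (big_fset_condE _ S (fun i => ~~ `[< P1 i >])).
rewrite !fpsME; apply: eq_bigr => k _; congr (_ * _).
  apply: E1; last by rewrite -ltnS.
    by move=> i; rewrite !inE => /andP[_ /asboolP].
  move=> i i1; rewrite !inE SS ?inE ?i1 //=; do 2!apply/asboolP; exact: PS1.
apply: E2; last exact: leq_subr.
  by move=> i; rewrite !inE => /andP[/PS' iS /asboolP/iS].
move=> i i2; rewrite !inE SS ?inE ?i2 ?orbT //=; apply/asboolP => i1.
by apply: (P12 i); split=> //; apply: PS2.
Qed.

End InfiniteProducts.

(** * Closed walks and primitive orbits *)

Section Walks.
Variables (n : nat) (e : rel 'I_n).
Implicit Types (i j k : 'I_n) (w : seq (arc_of n)).

(** Free endpoints make a recursion on the first arc possible, parallel to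
    [A ^+ m.+1 = A * A ^+ m]. *)
Fixpoint walk_between i w j : bool :=
  if w is a :: w' then [&& a.1 == i, e a.1 a.2 & walk_between a.2 w' j]
  else i == j.

Fixpoint walks m i j : seq (seq (arc_of n)) :=
  if m is m'.+1 then
    [seq (i, k) :: w | k <- [seq k <- enum 'I_n | e i k], w <- walks m' k j]
  else if i == j then [:: [::]] else [::].

Lemma mem_walks m i j w :
  (w \in walks m i j) = (size w == m) && walk_between i w j.
Proof.
elim: m i w => [|m IH] i w /=.
  by case: w => [|a w] /=; case: (i == j); rewrite ?inE.
apply/allpairsPdep/idP => [[k [w' [+ + ->]]]|].
  by rewrite mem_filter IH /= eqSS eqxx => /andP[-> _].
case: w => [|[i' k] w] //=; rewrite eqSS => /and4P[sw /eqP-> ik wkj].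
by exists k, w; rewrite mem_filter ik mem_enum IH sw wkj.
Qed.

Lemma uniq_walks m i j : uniq (walks m i j).
Proof.
elim: m i => [|m IH] i /=; first by case: (i == j).
apply: allpairs_uniq_dep => [|k _|]; first by rewrite filter_uniq ?enum_uniq.
  exact: IH.
by move=> [k w] [k' w'] _ _ /= [-> ->].
Qed.

Lemma size_walks m i j : (size (walks m i j))%:R = (adjacency e ^+ m) i j.
Proof.
elim: m i => [|m IH] i /=; first by rewrite expr0 mxE; case: (i == j).
rewrite size_allpairs_dep exprS mxE sumnE big_map big_filter natr_sum.
rewrite big_enum_cond big_mkcond; apply: eq_bigr => k _ /=.
by rewrite mxE -IH; case: (e i k); rewrite ?mul1r ?mul0r.
Qed.

Lemma walk_betweenE i w j : walk_between i w j =
  all (fun a => e a.1 a.2) w &&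
  (if w is a :: w' then
     [&& a.1 == i, path (fun a b => a.2 == b.1) a w' & (last a w').2 == j]
   else i == j).
Proof.
elim: w i => //= a w IH i; rewrite IH; case: w {IH} => [|b w] /=.
  by case: (a.1 == i); case: (e _ _).
rewrite [b.1 == _]eq_sym.
by case: (a.1 == i); case: (e _ _); case: (e _ _); case: (a.2 == b.1);
   case: all; rewrite ?andbF.
Qed.

Lemma walk_between_closed i w : w != [::] ->
  walk_between i w i = is_closed_walk e w && ((head (i, i) w).1 == i).
Proof.
case: w => // a w _; rewrite walk_betweenE /is_closed_walk /= rcons_path.
case: (a.1 =P i) => [<-|_]; last by rewrite !andbF.
by rewrite !andbT /= -!andbA.
Qed.

(** Listing by base vertex makes the length of the list a trace. *)
Definition closed_walks m := flatten [seq walks m i i | i <- enum 'I_n].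

Lemma mem_closed_walks m w : (0 < m)%N ->
  (w \in closed_walks m) = (size w == m) && is_closed_walk e w.
Proof.
move=> m0; apply/flatten_mapP/andP => [[i _]|[sw cw]].
  rewrite mem_walks => /andP[sw]; rewrite walk_between_closed.
    by move=> /andP[-> _].
  by rewrite -size_eq0 (eqP sw) -lt0n.
case: w sw cw => [|a w] sw cw; first by rewrite -(eqP sw) in m0.
exists a.1; first exact: mem_enum.
by rewrite mem_walks sw walk_between_closed //= cw eqxx.
Qed.

(** The base vertex is read off the first arc. For [m = 0] the empty walk would be listed once per
    vertex. *)
Lemma uniq_closed_walks m : (0 < m)%N -> uniq (closed_walks m).
Proof.
move=> m0; have := enum_uniq 'I_n; rewrite /closed_walks.
elim: (enum 'I_n) => //= i s IH /andP[is_ us].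
rewrite cat_uniq uniq_walks IH //.
rewrite andbT; apply/hasPn => w /flatten_mapP[j js]; rewrite /= !mem_walks.
move=> /andP[/eqP sw]; have w0 : w != [::] by rewrite -size_eq0 sw -lt0n.
rewrite sw eqxx !walk_between_closed //= => /andP[_].
case: w w0 {sw} => // a w _ /= /eqP aj; rewrite aj.
by apply: contra is_ => /andP[_ /eqP <-].
Qed.

Lemma size_closed_walks m :
  (size (closed_walks m))%:R = \tr (adjacency e ^+ m).
Proof.
rewrite size_flatten sumnE /shape -map_comp big_map natr_sum big_enum /=.
by apply: eq_bigr => i _; rewrite size_walks.
Qed.

Lemma is_closed_walk_flatten q w :
  is_closed_walk e (flatten (nseq q.+1 w)) = is_closed_walk e w.
Proof.
rewrite /is_closed_walk all_flatten_nseq cycle_flatten_nseq.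
by rewrite -!size_eq0 size_flatten_nseq muln_eq0.
Qed.

Lemma is_closed_walk_rot r w :
  is_closed_walk e (rot r w) = is_closed_walk e w.
Proof.
rewrite /is_closed_walk rot_cycle -!size_eq0 size_rot.
by have /perm_all-> : perm_eq (rot r w) w by rewrite perm_rot.
Qed.

End Walks.

(** * Primitive orbits and the count of closed walks *)

Section PrimitiveOrbits.
Local Open Scope quotient_scope.
Local Open Scope nat_scope.
Variables (n : nat) (e : rel 'I_n).
Implicit Types (w : closed_walk e) (o : walk_orbit e) (P : set (walk_orbit e)).

Lemma closed_walk_neq0 w : (w : seq _) != [::].
Proof. by case/and3P: (closed_walkP w). Qed.

Lemma closed_walk_size_gt0 w : 0 < size w.
Proof. by rewrite lt0n size_eq0 closed_walk_neq0. Qed.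

Lemma orbit_length_gt0 o : 0 < orbit_length o.
Proof. exact: closed_walk_size_gt0. Qed.

(** A power of [v] is fixed by rotation by [size v]. Conversely, if [rot k] fixes [w], then [w] is a
    power of its prefix of length [gcdn k (size w)], which is itself a closed walk. *)
Lemma primitive_walkP w : primitive_walk w <-> aperiodic w.
Proof.
split=> [pw k /andP[k0 kw] rk|aw [k [v [k1 wE]]]]; last first.
  have v0 := closed_walk_size_gt0 v.
  apply: (aw (size v)); last by rewrite wE rot_flatten_nseq.
  by rewrite v0 wE size_flatten_nseq ltn_Pmull.
have w0 := closed_walk_size_gt0 w.
set g := gcdn k (size w).
have gw : g %| size w := dvdn_gcdr _ _.
have g0 : 0 < g by rewrite gcdn_gt0 k0.
have ltgw : g < size w by rewrite (leq_ltn_trans _ kw) // dvdn_leq ?dvdn_gcdl.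
have rg : rot g w = w by apply: rot_gcdn; rewrite ?k0 ?(ltnW kw) ?rot_size.
have wE := rot_period gw rg.
have q1 : 1 < size w %/ g.
  by rewrite ltn_divRL // mul1n.
have ct : is_closed_walk e (take g w).
  rewrite -(is_closed_walk_flatten _ (size w %/ g).-1) prednK -?wE.
    exact: closed_walkP.
  exact: ltnW.
by apply: pw; exists (size w %/ g), (ClosedWalk ct).
Qed.

Lemma pi_rot o w : \pi_(walk_orbit e) w = o <-> exists k, rot k (repr o) = w.
Proof.
split=> [<-|[k kw]].
  have /eqP : \pi_(walk_orbit e) (repr (\pi_(walk_orbit e) w)) = \pi w.
    exact: reprK.
  by rewrite eqmodE /= => /same_orbitP.
rewrite -[o]reprK; apply/esym/eqP; rewrite eqmodE /=; apply/same_orbitP.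
by exists k.
Qed.

(** Aperiodicity is invariant under rotation, so one representative decides. *)
Lemma primitiveP o : primitive o <-> aperiodic (repr o).
Proof.
split=> [po|ao w /pi_rot[k kw]]; apply/primitive_walkP.
  by apply: po; exact: reprK.
by rewrite -kw; exact: aperiodic_rot.
Qed.

(** Finiteness comes from projecting the finite lists of closed walks of lengths 1 to [m]. *)
Definition orbits_upto P m : {fset walk_orbit e} :=
  [fset o in [seq \pi_(walk_orbit e) w | w <-
      pmap insub (flatten [seq closed_walks e k | k <- iota 1 m])]
  | `[< P o >] && (orbit_length o <= m)]%fset.

Lemma in_orbits_upto P m o :
  (o \in orbits_upto P m) = `[< P o >] && (orbit_length o <= m).
Proof.
rewrite !inE /=; case: asboolP => //= _; last by rewrite andbF.
case: leqP => om; rewrite ?andbF //= andbT; apply/mapP; exists (repr o).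
  rewrite mem_pmap_sub; apply/flatten_mapP; exists (orbit_length o).
    by rewrite mem_iota add1n ltnS om orbit_length_gt0.
  by rewrite mem_closed_walks ?orbit_length_gt0 // eqxx; exact: closed_walkP.
by rewrite reprK.
Qed.

(** The map [pw], sending an orbit and a starting point to the power of length [k] of that rotation,
    is a bijection onto the closed walks of length [k]. *)
Lemma size_closed_walks_orbits m k : 0 < k <= m ->
  size (closed_walks e k) =
    \sum_(o <- orbits_upto (primitive_orbits e) m | orbit_length o %| k)
      orbit_length o.
Proof.
move=> /andP[k0 km].
pose os := [seq o <- orbits_upto (primitive_orbits e) m | orbit_length o %| k].
pose pw o i := flatten (nseq (k %/ orbit_length o) (rot i (repr o))).
have osP o : o \in os -> aperiodic (repr o) /\ orbit_length o %| k.
  by rewrite mem_filter in_orbits_upto => /and3P[ok /asboolP/primitiveP].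
have q0 o : o \in os -> 0 < k %/ orbit_length o.
  by case/osP=> _ ok; rewrite divn_gt0 ?orbit_length_gt0 // dvdn_leq.
transitivity (size [seq pw o i | o <- os, i <- iota 0 (orbit_length o)]).
  apply: perm_size; apply: uniq_perm.
  - exact: uniq_closed_walks.
  (* Injectivity: [aperiodic_root] recovers the rotated representative, which determines the orbit
     and then, by aperiodicity, the index. *)
  - apply: allpairs_uniq_dep => [|o _|].
    + by rewrite filter_uniq ?fset_uniq.
    + exact: iota_uniq.
    move=> [o i] [o' i'] /allpairsPdep[x [y [xos + [-> ->]]]].
    rewrite mem_iota /= => yx /allpairsPdep[x' [y' [x'os + [-> ->]]]].
    rewrite mem_iota /= => yx' E.
    have [ax _] := osP _ xos; have [ax' _] := osP _ x'os.
    have : rot y (repr x) = rot y' (repr x').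
      apply: aperiodic_root E; rewrite ?size_rot ?q0 ?closed_walk_size_gt0 //;
        exact: aperiodic_rot.
    move=> ryy.
    have xx' : x = x'.
      have cw : is_closed_walk e (rot y (repr x)).
        by rewrite is_closed_walk_rot; exact: closed_walkP.
      have <- : \pi_(walk_orbit e) (ClosedWalk cw) = x.
        by apply/pi_rot; exists y.
      by apply/pi_rot; exists y'.
    rewrite -{}xx' in ryy yx' *.
    by rewrite (aperiodic_inj ax _ _ ryy).
  - move=> w; rewrite mem_closed_walks //.
    apply/andP/allpairsPdep => [[/eqP sw cw]|[o [i [oos _ ->]]]]; last first.
      have [_ ok] := osP _ oos.
      rewrite size_flatten_nseq size_rot divnK // eqxx; split=> //.
      rewrite /pw -(prednK (q0 _ oos)).
      rewrite is_closed_walk_flatten is_closed_walk_rot.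
      exact: closed_walkP.
    (* Surjectivity: take the orbit of the aperiodic root of [w]. *)
    have w0 : w != [::] by rewrite -size_eq0 sw -lt0n.
    have [d [d0 dw rd ad]] := exists_root w0.
    have wE := rot_period dw rd; rewrite sw in dw wE.
    have dk : d <= k by exact: dvdn_leq.
    have std : size (take d w) = d by rewrite size_takel // sw.
    have ct : is_closed_walk e (take d w).
      rewrite -(is_closed_walk_flatten _ (k %/ d).-1) prednK -?wE //.
      by rewrite divn_gt0.
    pose o := \pi_(walk_orbit e) (ClosedWalk ct).
    have od : orbit_length o = d by rewrite orbit_length_pi.
    have [i ro] : exists i, rot i (repr o) = take d w.
      by apply: (iffLR (pi_rot _ (ClosedWalk ct))).
    have ao : aperiodic (repr o).
      rewrite -[_ (repr o)](rotK i); rewrite ro; exact: aperiodic_rot.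
    have oos : o \in os.
      rewrite mem_filter in_orbits_upto od dw (leq_trans dk km) andbT.
      by apply/asboolP/primitiveP.
    (* An index [i >= d] rotates trivially and is replaced by 0. *)
    exists o; have [iw|wi] := ltnP i d.
      by exists i; rewrite mem_iota od iw /pw od ro -wE.
    exists 0; rewrite mem_iota od d0 /pw od rot0; split=> //.
    by move: ro; rewrite rot_oversize -?[size _]/(orbit_length o) ?od // => ->.
rewrite size_allpairs_dep sumnE big_map big_filter.
by apply: eq_bigr => o _; rewrite size_iota.
Qed.

End PrimitiveOrbits.

(** * The Euler product *)

Section EulerProduct.
Variables (n : nat) (e : rel 'I_n).
Implicit Types (o : walk_orbit e) (P : set (walk_orbit e)).

(** The geometric series, verified by multiplying by [1 - u^l]. *)
Lemma euler_factorE o :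
  euler_factor e o = Fps (fun k => (orbit_length o %| k)%:R).
Proof.
rewrite /euler_factor div1r; apply: (mulrI (euler_factor_unit o)).
rewrite divrr ?euler_factor_unit // mulrC rmorphB rmorph1 mulrBr mulr1.
apply: fpsP => k; rewrite fpsDE fpsNE fps_mulXn fps1E /=.
case: leqP => [lk|kl]; first by rewrite dvdn_subl // subrr eqn0Ngt
  (leq_trans (orbit_length_gt0 o) lk).
rewrite subr0; case: k kl => [|k] kl; first by rewrite dvdn0.
by rewrite gtnNdvd.
Qed.

Lemma euler_factor_eq1 o m : (m < orbit_length o)%N ->
  forall k, (k <= m)%N -> euler_factor e o k = (1 : fps int) k.
Proof.
move=> mo [|k] km; rewrite euler_factorE fps1E /= ?dvdn0 //.
by rewrite gtnNdvd // (leq_trans _ mo).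
Qed.

(** This is [l u^l / (1 - u^l)]; the test [0 < k] discards the constant term, as [l] divides 0. *)
Definition euler_log o : fps int :=
  Fps (fun k => ((0 < k) && (orbit_length o %| k))%N%:R *+ orbit_length o).

Lemma theta_euler_factor o :
  fps_theta (euler_factor e o) = euler_log o * euler_factor e o.
Proof.
rewrite {2}/euler_factor [in LHS]/euler_factor !div1r.
apply: fps_theta_inv; first exact: euler_factor_unit.
have l0 := orbit_length_gt0 o.
rewrite rmorphB rmorph1 mulrBr mulr1; apply: fpsP => k.
rewrite fpsDE !fpsNE fps_mulXn /= coefXn.
(* In [euler_log o * (1 - u^l)] the coefficients at [k] and [k - l] cancel, except at [k = l], where
   the second is the discarded constant term. *)
have [->|kl] := eqVneq k (orbit_length o).
  rewrite leqnn subnn dvdnn l0 eqn0Ngt l0 /=.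
  by rewrite mul0rn oppr0 subr0 sub0r mulNrn.
rewrite subr0; have [->|k0] := posnP k.
  by rewrite mulr0n leqNgt l0 mul0rn oppr0 subr0.
rewrite mul0rn /=.
case: (leqP (orbit_length o) k) => [lk|ltkl]; last first.
  by rewrite gtnNdvd //= mul0rn oppr0 subr0.
by rewrite dvdn_subl // subn_gt0 ltn_neqAle eq_sym kl lk opprK addNr.
Qed.

(** Orbits longer than [m] have factors equal to 1 up to degree [m], so coefficient [m] is already
    that of the product over [orbits_upto P m]. *)
Lemma euler_factor_has_prod P : fps_has_prod P (euler_factor e)
  (Fps (fun m => (\prod_(o <- orbits_upto P m) euler_factor e o) m)).
Proof.
move=> m; exists (orbits_upto P m); split=> [o|S PS SS].
  by rewrite in_orbits_upto => /andP[/asboolP].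
have SE : [fset o in S | (orbit_length o <= m)%N]%fset = orbits_upto P m.
  apply/fsetP => o; rewrite in_orbits_upto !inE /=.
  apply/andP/andP => -[oS om]; split=> //; first exact/asboolP/PS.
  by apply: SS; rewrite in_orbits_upto oS.
rewrite (bigID (fun o => orbit_length o <= m)%N) (@fps_mul_eq1 _ m) //=.
  by rewrite big_fset_condE SE.
by apply: fps_prod_eq1 => o; rewrite -ltnNge; exact: euler_factor_eq1.
Qed.

(** For each [m], zeta is compared with a finite product, whose logarithmic derivative is correct
    only up to degree [m]; hence the truncated form of [fps_theta_uniq]. *)
Lemma zeta_has_prod :
  fps_has_prod (primitive_orbits e) (euler_factor e) (zeta (adjacency e)).
Proof.
move=> m; have [S [PS E]] := euler_factor_has_prod (primitive_orbits e) m.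
exists S; split=> // S' PS' SS'; rewrite E //=; apply/esym.
apply: (fps_theta_uniq (theta_zeta _)
  (fps_theta_prod _ theta_euler_factor) _ _ _
  (leqnn m)) => //.
- rewrite zeta0 (@fps_prod_eq1 _ _ 0%N) // => o _.
  by apply: euler_factor_eq1; exact: orbit_length_gt0.
- move=> k km; rewrite fps_sumE /=; case: k km => [|k] km.
    by rewrite big1 // => o _; rewrite mul0rn.
  rewrite -size_closed_walks (@size_closed_walks_orbits _ _ m) // natr_sum.
  rewrite big_mkcond; apply: eq_bigr => o _.
  by case: ifP => /=; rewrite ?mul0rn.
Qed.

End EulerProduct.

Theorem mainTheorem11 (n : nat) (e : rel 'I_n) :
  [/\ fps_multipliable (primitive_orbits e) (euler_factor e),
      fps_multipliable (nonbacktracking_primitive_orbits e) (euler_factor e)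
    & fps_multipliable (backtracking_primitive_orbits e) (euler_factor e)]
  /\ zeta (adjacency e) = fps_prod (primitive_orbits e) (euler_factor e)
  /\ zeta (adjacency e) = zeta_I e * zeta_b e.
Proof.
have HI := euler_factor_has_prod (nonbacktracking_primitive_orbits e).
have Hb := euler_factor_has_prod (backtracking_primitive_orbits e).
split; first by split; eexists; exact: euler_factor_has_prod.
split; first by rewrite (fps_prodE (zeta_has_prod e)).
rewrite /zeta_I /zeta_b (fps_prodE HI) (fps_prodE Hb).
(* By uniqueness of limits, it remains to see that [zeta_I e * zeta_b e] is also a product over all
   primitive orbits. *)
apply: fps_has_prod_unique (zeta_has_prod e) _.
have -> : primitive_orbits e = (nonbacktracking_primitive_orbits e `|`
                                backtracking_primitive_orbits e)%classic.
  apply/seteqP; split=> [o po|o [[]|[]]] //.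
  by have [bo|bo] := EM (backtracks o); [right|left].
apply: fps_has_prodU => //; apply/disj_setPS => o [[_ nbo] [_ bo]].
exact: nbo.
Qed.
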